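(* Let $\alpha > 1$ be fixed, and for each dimension $d$ let $L \subset \mathcal{S}$ consist of $n = \alpha^d$ independent uniformly random vectors from the unit sphere $\mathcal{S} = \{\mathbf{x} \in \mathbb{R}^d : \|\mathbf{x}\| = 1\}$. Then, with probability $1 - o(1)$ over the randomness of $L$ (as $d \to \infty$), $$\operatorname{vol}(\mathcal{V}_L) = \left(\frac{\alpha^2}{4\alpha^2 - 4}\right)^{d/2 + o(d)} \operatorname{vol}(\mathcal{B}),$$ where $\mathcal{B} = \{\mathbf{x} \in \mathbb{R}^d : \|\mathbf{x}\| \leq 1\}$ is the unit ball.
   Context: For $\mathbf{v} \in \mathbb{R}^d$, $\mathcal{H}_{\mathbf{v}} := \{\mathbf{x} \in \mathbb{R}^d : \|\mathbf{x}\| \leq \|\mathbf{x} - \mathbf{v}\|\}$ (Euclidean norm), and for $L \subset \mathbb{R}^d$ with $\mathbf{0} \notin L$, $\mathcal{V}_L := \bigcap_{\mathbf{v} \in L} \mathcal{H}_{\mathbf{v}}$ (a possibly unbounded convex polytope; its volume may be infinite). Asymptotic notation refers to $d \to \infty$ with $\alpha$ fixed.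
   Formalization: When α² = 4/3 the base is 1 and the literal formula would force vol(V_L) = vol(B) exactly, which is false; the literal formula is proved for base ≠ 1, and for every α > 1 the form base^(d/2)·e^{o(d)}·vol(B) is proved. n is any integer with |n − α^d| < 1. *)

(* Defs.v *)
From HB Require Import structures.
From mathcomp Require Import all_boot all_order all_algebra.
From mathcomp Require Import all_classical all_reals all_analysis.

Set Implicit Arguments.
Unset Strict Implicit.
Unset Printing Implicit Defensive.

Import Order.TTheory GRing.Theory Num.Theory.
Import numFieldNormedType.Exports.

Local Open Scope classical_set_scope.
Local Open Scope ring_scope.

(* R^d is represented by d.-tuple R, which carries the product sigma-algebra. *)
Section euclidean.
Context {R : realType}.
Implicit Types d : nat.

Definition enorm d (x : d.-tuple R) : R :=
  Num.sqrt (\sum_(i < d) tnth x i ^+ 2).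

Definition tsub d (x y : d.-tuple R) : d.-tuple R :=
  [tuple tnth x i - tnth y i | i < d].

Definition tscale d (a : R) (x : d.-tuple R) : d.-tuple R :=
  [tuple a * tnth x i | i < d].

Definition unit_sphere d : set (d.-tuple R) := [set x | enorm x = 1].

Definition unit_ball d : set (d.-tuple R) := [set x | enorm x <= 1].

Definition half_space d (v : d.-tuple R) : set (d.-tuple R) :=
  [set x | enorm x <= enorm (tsub x v)].

Definition voronoi d (L : set (d.-tuple R)) : set (d.-tuple R) :=
  \bigcap_(v in L) half_space v.

Definition tcons d (p : R * d.-tuple R) : d.+1.-tuple R :=
  [tuple of p.1 :: p.2].

(* d-dimensional Lebesgue measure: the d-fold product of lebesgue_measure,
   transported along R * R^d ~ R^(d+1). *)
Fixpoint vol d : set (d.-tuple R) -> \bar R :=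
  match d return set (d.-tuple R) -> \bar R with
  | 0 => \d_([tuple] : 0.-tuple R)
  | d'.+1 => pushforward (lebesgue_measure \x @vol d')%E (@tcons d')
  end.

(* Uniform probability on the sphere, i.e. normalised surface measure, in its
   cone form: A has the mass of the fraction of the ball that lies on the rays
   through A. For d = 0 the sphere is empty and this is the zero measure. *)
Definition sphere_uniform d (A : set (d.-tuple R)) : \bar R :=
  (vol [set tscale r s | r in `]0%R, 1%R] & s in unit_sphere (d := d) `&` A]
   / vol (unit_ball (d := d)))%E.

End euclidean.

Arguments unit_sphere {R} d.
Arguments unit_ball {R} d.

Section independence.
Context {R : realType}.

Definition independent_RVs (disp disp' : measure_display)
    (T : measurableType disp) (U : measurableType disp') (P : probability T R)
    (I : finType) (X : I -> {RV P >-> U}) : Prop :=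
  forall (J : {set I}) (A : I -> set U), (forall i, measurable (A i)) ->
    P (\bigcap_(i in [set` J]) (X i @^-1` A i))
    = (\prod_(i in J) P (X i @^-1` A i))%E.

End independence.

Section vol_measure.
Context {R : realType}.
Local Open Scope ereal_scope.

Lemma measurable_tcons d : measurable_fun setT (@tcons R d).
Proof. exact: (@measurable_cons _ _ _ R fst d snd). Qed.

Let sigma_finite_measure_of (disp : measure_display) (T : measurableType disp)
    (mu : set T -> \bar R) : mu set0 = 0 -> (forall A, 0 <= mu A) ->
    semi_sigma_additive mu -> sigma_finite setT mu ->
  exists m : {sigma_finite_measure set T -> \bar R}, m = mu :> (set T -> \bar R).
Proof.
move=> mu0 mu_ge0 mu_sa mu_sf.
pose M1 := isMeasure.Build _ _ _ mu mu0 mu_ge0 mu_sa.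
pose M : {measure set T -> \bar R} := HB.pack mu M1.
pose S1 := Measure_isSigmaFinite.Build _ _ _ M mu_sf.
pose S : {sigma_finite_measure set T -> \bar R} := HB.pack mu M1 S1.
by exists S.
Qed.

Lemma vol_sigma_finite_measure d :
  exists m : {sigma_finite_measure set (d.-tuple R) -> \bar R},
    m = @vol R d :> (set (d.-tuple R) -> \bar R).
Proof.
elim: d => [|d [m mE]].
  by exists (\d_([tuple] : 0.-tuple R) : {sigma_finite_measure set _ -> \bar _}).
pose mu := pushforward (@lebesgue_measure R \x m) (@tcons R d).
have mu0 : mu set0 = 0 by rewrite /mu /pushforward preimage_set0 measure0.
have mu_ge0 A : 0 <= mu A by rewrite /mu /pushforward; apply: (measure_ge0 (@lebesgue_measure R \x m)%E).
have mu_sa : semi_sigma_additive mu.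
  have mpre A : measurable A -> measurable (@tcons R d @^-1` A).
    by move=> mA; rewrite -[X in measurable X]setTI; exact: measurable_tcons.
  move=> F mF tF mUF; rewrite /mu /pushforward preimage_bigcup.
  apply: (@measure_semi_sigma_additive _ _ _ (@lebesgue_measure R \x m)%E).
  - by move=> k; exact: mpre.
  - apply/trivIsetP => /= i j _ _ ij; rewrite -preimage_setI.
    by move/trivIsetP : tF => /(_ _ _ _ _ ij) ->//; rewrite preimage_set0.
  - by rewrite -preimage_bigcup; exact: mpre.
have mu_sf : sigma_finite setT mu.
  have /sigma_finiteP[F [TF ndF Foo]] := sigma_finiteT (@lebesgue_measure R).
  have /sigma_finiteP[G [TG ndG Goo]] := sigma_finiteT m.
  pose h (t : d.+1.-tuple R) : R * d.-tuple R := (thead t, [tuple of behead t]).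
  have hK : h \o @tcons R d = id.
    by apply/funext => -[x t]; congr pair; apply/val_inj.
  have mh : measurable_fun setT h.
    by apply: measurable_fun_pair;
      [exact: measurable_tnth|exact: measurable_behead].
  exists (fun k => h @^-1` (F k `*` G k)).
    rewrite -preimage_bigcup (_ : \bigcup_k _ = setT) ?preimage_setT //.
    rewrite -subTset => -[x t] _.
    have [i _ Fix] : (\bigcup_i F i) x by rewrite -TF.
    have [j _ Gjt] : (\bigcup_j G j) t by rewrite -TG.
    exists (maxn i j) => //; split => /=.
    - by move: x Fix; exact/subsetPset/ndF/leq_maxl.
    - by move: t Gjt; exact/subsetPset/ndG/leq_maxr.
  move=> k; have [mF Fk] := Foo k; have [mG Gk] := Goo k; split.
    by rewrite -[X in measurable X]setTI; apply: mh => //; exact: measurableX.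
  rewrite /mu /pushforward -comp_preimage hK preimage_id.
  by rewrite product_measure1E// lte_mul_pinfty// ge0_fin_numE.
have [S SE] := sigma_finite_measure_of mu0 mu_ge0 mu_sa mu_sf.
by exists S; rewrite SE /mu mE.
Qed.

Lemma vol_box d (A : 'I_d -> set R) : (forall i, measurable (A i)) ->
  vol [set x | forall i, A i (tnth x i)] = \prod_(i < d) lebesgue_measure (A i).
Proof.
elim: d A => [|d IH] A mA.
  rewrite big_ord0 /= diracE mem_set //; by case.
have [m mE] := vol_sigma_finite_measure d.
rewrite big_ord_recl /= /pushforward.
rewrite (_ : _ @^-1` _ =
  A ord0 `*` [set x : d.-tuple R | forall i, A (lift ord0 i) (tnth x i)]).
  have mB : measurable
      [set x : d.-tuple R | forall i, A (lift ord0 i) (tnth x i)].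
    rewrite (_ : mkset _ = \bigcap_(i in [set: 'I_d])
      ((fun x : d.-tuple R => tnth x i) @^-1` A (lift ord0 i))).
      by apply: fin_bigcap_measurable => // i _;
        rewrite -[X in measurable X]setTI; exact: measurable_tnth.
    by apply/seteqP; split => x /= H; [move=> i _|move=> i]; exact: H.
  have <- := IH (fun i => A (lift ord0 i)) (fun i => mA (lift ord0 i)).
  rewrite -mE.
  exact: (product_measure1E (@lebesgue_measure R) m (mA ord0) mB).
apply/seteqP; split => -[x t] /=.
  by move=> H; split=> [|i]; [exact: (H ord0)|have := H (lift ord0 i); rewrite tnthS].
move=> [Ax At] i; case: (unliftP ord0 i) => [j ->|->]; last exact: Ax.
by rewrite tnthS.
Qed.

End vol_measure.

(* Main.v *)
Require Import Defs.
From HB Require Import structures.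
From mathcomp Require Import all_boot all_order all_algebra.
From mathcomp Require Import all_classical all_reals all_analysis.
From mathcomp Require Import measurable_realfun ring lra.

Set Implicit Arguments.
Unset Strict Implicit.
Unset Printing Implicit Defensive.

Import Order.TTheory GRing.Theory Num.Theory.
Import numFieldNormedType.Exports.

Local Open Scope classical_set_scope.
Local Open Scope ring_scope.

(** Write [V] for the Voronoi cell and [s = sqrt b].  A point [x] is cut off by a
    uniform unit vector [v] iff [<x, v> > 1/2], an event whose probability is the
    volume of the cone [|y| <= 1, <x, y> > |y| / 2] relative to that of the unit
    ball, hence [(1 - 1 / (4 |x|^2))^(d/2 + o(d))].  This exceeds [1/n] exactly
    beyond the radius [s].

    - For [r < s] the expected volume of [B(r) \ V] is [o(vol (B(r)))], so by
      Markov [vol V >= vol (B(r)) / 2] with high probability.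
    - For [s < r1 < r2] the expected volume of [V] in the shell
      [r1 <= |x| <= r2] is doubly exponentially small.  As [V] is convex and
      contains [B(1/2)], if it left [B(r2)] it would contain a ball of fixed
      radius inside the shell; hence [V] lies in [B(r2)] with high probability.

    Both cone estimates use only the behaviour of the volume under translations
    and dilations, so no rotation invariance is needed. *)

(** * Inner product and Euclidean norm on tuples *)

Section inner_product.
Context {R : realType} {d : nat}.
Implicit Types x y z : d.-tuple R.

Definition dot x y : R := \sum_(i < d) tnth x i * tnth y i.

Definition affine (a : R) (v x : d.-tuple R) : d.-tuple R :=
  [tuple a * tnth x i + tnth v i | i < d].

Lemma dotC x y : dot x y = dot y x.
Proof. by apply: eq_bigr => i _; rewrite mulrC. Qed.

Lemma dot_affinel a v x y : dot (affine a v x) y = a * dot x y + dot v y.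
Proof.
rewrite /dot mulr_sumr -big_split/=; apply: eq_bigr => i _.
by rewrite tnth_mktuple mulrDl mulrA.
Qed.

Lemma dot_affiner a v x y : dot y (affine a v x) = a * dot y x + dot y v.
Proof. by rewrite dotC dot_affinel !(dotC y). Qed.

Lemma dot_tscalel a x y : dot (tscale a x) y = a * dot x y.
Proof.
by rewrite /dot mulr_sumr; apply: eq_bigr => i _; rewrite tnth_mktuple mulrA.
Qed.

Lemma dot_tscaler a x y : dot y (tscale a x) = a * dot y x.
Proof. by rewrite dotC dot_tscalel dotC. Qed.

Lemma dot_tsubl x y z : dot (tsub x y) z = dot x z - dot y z.
Proof.
rewrite /dot -sumrB; apply: eq_bigr => i _.
by rewrite tnth_mktuple mulrBl.
Qed.

Lemma dot_tsubr x y z : dot z (tsub x y) = dot z x - dot z y.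
Proof. by rewrite dotC dot_tsubl !(dotC z). Qed.

Lemma dot_ge0 x : 0 <= dot x x.
Proof. by apply: sumr_ge0 => i _; rewrite -expr2 sqr_ge0. Qed.

Lemma enormE x : enorm x = Num.sqrt (dot x x).
Proof. by congr Num.sqrt; apply: eq_bigr => i _; rewrite expr2. Qed.

Lemma enorm_ge0 x : 0 <= enorm x. Proof. exact: sqrtr_ge0. Qed.

Lemma enorm_sqr x : enorm x ^+ 2 = dot x x.
Proof. by rewrite enormE sqr_sqrtr// dot_ge0. Qed.

Lemma enorm_le r x : 0 <= r -> (enorm x <= r) = (dot x x <= r ^+ 2).
Proof. by move=> r0; rewrite -enorm_sqr ler_pXn2r// nnegrE ?enorm_ge0. Qed.

Lemma enorm_ge r x : 0 <= r -> (r <= enorm x) = (r ^+ 2 <= dot x x).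
Proof. by move=> r0; rewrite -enorm_sqr ler_pXn2r// nnegrE ?enorm_ge0. Qed.

Lemma enorm_eq0_dot x y : enorm x = 0 -> dot x y = 0.
Proof.
move=> x0; have := enorm_sqr x; rewrite x0 expr0n/= => /esym /eqP.
rewrite psumr_eq0; last by move=> i _; rewrite -expr2 sqr_ge0.
move=> /allP h; rewrite /dot big1// => i _.
have /= := h i (mem_index_enum _); rewrite mulf_eq0 orbb => /eqP ->.
by rewrite mul0r.
Qed.

(** Cauchy-Schwarz: the squared norm of [<x, y> x - |x|^2 y] is nonnegative and equals
    [|x|^2 (|x|^2 |y|^2 - <x, y>^2)]. *)
Lemma dot_le_enorm x y : dot x y <= enorm x * enorm y.
Proof.
have [x0|x0] := eqVneq (enorm x) 0; first by rewrite enorm_eq0_dot// x0 mul0r.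
have xp : 0 < enorm x by rewrite lt_neqAle eq_sym x0 enorm_ge0.
have := dot_ge0 (tsub (tscale (dot x y) x) (tscale (enorm x ^+ 2) y)).
rewrite dot_tsubl !dot_tsubr !dot_tscalel !dot_tscaler (dotC y x).
rewrite -!enorm_sqr => h.
have {}h : 0 <= (enorm x ^+ 2) * ((enorm x * enorm y) ^+ 2 - dot x y ^+ 2).
  by move: h; congr (_ <= _); ring.
rewrite pmulr_rge0 ?exprn_gt0// subr_ge0 in h.
apply: (le_trans (ler_norm _)).
by rewrite -ler_sqr ?nnegrE ?mulr_ge0 ?enorm_ge0// real_normK ?num_real.
Qed.

Lemma normr_dot_le x y : `|dot x y| <= enorm x * enorm y.
Proof.
rewrite ler_norml dot_le_enorm andbT lerNl.
have -> : - dot x y = dot (tscale (-1) x) y by rewrite dot_tscalel mulN1r.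
rewrite (le_trans (dot_le_enorm _ _))//.
by rewrite enormE dot_tscalel dot_tscaler !mulN1r opprK -enormE.
Qed.

(** After squaring, the terms [dot x x] cancel, which leaves a condition linear in [x]. *)
Lemma half_spaceE v x : half_space v x <-> dot x v <= dot v v / 2.
Proof.
rewrite /half_space/= !enormE ler_sqrt ?dot_ge0//.
rewrite dot_tsubl !dot_tsubr (dotC v x); split => h; lra.
Qed.

End inner_product.

(** * Lebesgue measure under dilations and translations *)

Section vol_affine.
Context {R : realType}.

(** [vol] is a bare set function; this is the same function carrying its sigma-finite measure
    structure. *)
Definition vol_measure d : {sigma_finite_measure set (d.-tuple R) -> \bar R} :=
  sval (cid (vol_sigma_finite_measure d)).

Lemma vol_measureE d : vol_measure d = @vol R d :> (set _ -> _).
Proof. by rewrite /vol_measure; case: cid. Qed.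

Lemma measurable_preimage (d1 d2 : measure_display) (T1 : measurableType d1)
    (T2 : measurableType d2) (f : T1 -> T2) (A : set T2) :
  measurable_fun setT f -> measurable A -> measurable (f @^-1` A).
Proof. by move=> mf mA; rewrite -[X in measurable X]setTI; exact: mf. Qed.

Lemma measurable_affine d a (v : d.-tuple R) :
  measurable_fun setT (affine a v).
Proof.
apply/measurable_fun_tnthP => i.
rewrite (_ : _ \o _ = fun x : d.-tuple R => a * tnth x i + tnth v i); last first.
  by apply/funext => x /=; rewrite tnth_mktuple.
apply: measurable_funD => //; apply: measurable_funM => //.
exact: measurable_tnth.
Qed.

Local Open Scope ereal_scope.

(** Provides the competitor in the uniqueness arguments below: for an affine [f] and the right
    factor [k], the measure [m] turns out to be the original one. *)
Lemma scaled_pushforward_measure (d1 d2 : measure_display)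
    (T1 : measurableType d1) (T2 : measurableType d2)
    (mu : {measure set T1 -> \bar R}) (f : T1 -> T2) (k : R) :
  (0 <= k)%R -> measurable_fun setT f ->
  exists m : {measure set T2 -> \bar R},
    forall A, m A = k%:E * mu (f @^-1` A).
Proof.
move=> k0 mf.
have [m mE] : exists m : {measure set T2 -> \bar R},
    forall A, m A = mu (f @^-1` A).
  by unshelve eexists (pushforward mu f : {measure set T2 -> \bar R}).
exists (mscale (NngNum k0) m : {measure set T2 -> \bar R}) => A.
by rewrite /= /mscale/= mE.
Qed.

(** The pushforward of Lebesgue measure under [a * x + c], multiplied by [a], gives every interval
    []x, y]] its length, so it is Lebesgue measure. *)
Lemma lebesgue_measure_affine (a c : R) (A : set R) : (0 < a)%R ->
  measurable A ->
  lebesgue_measure ((fun x => a * x + c)%R @^-1` A) =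
    a^-1%:E * lebesgue_measure A.
Proof.
move=> a0 mA.
pose f (x : measurableTypeR R) : measurableTypeR R := (a * x + c)%R.
have mf : measurable_fun setT f.
  by apply: measurable_funD => //; exact: measurable_funM.
have [m mE] := scaled_pushforward_measure lebesgue_measure (ltW a0) mf.
have h : lebesgue_measure A = m A.
  apply: lebesgue_measure_unique => // _ [[x y]] _ <-.
  have fE : (f @^-1` `]x, y] = `](x - c) / a, (y - c) / a])%classic%R.
    apply/seteqP; split => z /=; rewrite !in_itv/=;
    by rewrite /f ltr_pdivrMr// ler_pdivlMr// ltrBlDr lerBrDr (mulrC z).
  rewrite mE fE lebesgue_measure_itv/=.
  rewrite (lebesgue_measure_itv `](x - c) / a, (y - c) / a]%R)/=.
  rewrite !lte_fin ltr_pM2r ?invr_gt0// ltrD2r.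
  case: ifPn => _; last by rewrite mule0.
  by rewrite -!EFinB -EFinM; congr EFin; field; rewrite gt_eqF.
by rewrite h mE muleA -EFinM mulVf ?gt_eqF// mul1e.
Qed.

(** Induction on [d]: the pushforward multiplied by [a ^+ d.+1] agrees with the product measure on
    rectangles, by the case of the line and the induction hypothesis, hence everywhere. *)
Lemma vol_affine d (a : R) (v : d.-tuple R) (A : set (d.-tuple R)) :
  (0 < a)%R -> measurable A ->
  vol_measure d (affine a v @^-1` A) = (a^-1 ^+ d)%:E * vol_measure d A.
Proof.
move=> a0; elim: d v A => [|d IH] v A mA.
  rewrite expr0 mul1e; congr (vol_measure 0 _).
  by apply/seteqP; split => x /=; rewrite (tuple0 x) (tuple0 (affine _ _ _)).
have [t [c ->]] : exists t c, v = tcons (c, t).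
  exists [tuple of behead v], (thead v); rewrite [LHS]tuple_eta.
  exact/val_inj.
have volS B : vol_measure d.+1 B =
    (lebesgue_measure \x vol_measure d) (@tcons R d @^-1` B).
  by rewrite vol_measureE /= /pushforward -vol_measureE.
rewrite !volS.
set B := @tcons R d @^-1` A.
have mB : measurable B by apply: measurable_preimage => //; exact: measurable_tcons.
pose f (p : measurableTypeR R * d.-tuple R) : measurableTypeR R * d.-tuple R :=
  ((a * p.1 + c)%R, affine a t p.2).
have mf : measurable_fun setT f.
  apply: measurable_fun_pair.
    by apply: measurable_funD => //; exact: measurable_funM.
  by apply: measurableT_comp => //; exact: measurable_affine.
have -> : @tcons R d @^-1` (affine a (tcons (c, t)) @^-1` A) = f @^-1` B.
  apply/funext => -[x s] /=; congr A.
  apply: eq_from_tnth => i; rewrite tnth_mktuple.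
  by case: (unliftP ord0 i) => [j ->|->//]; rewrite !tnthS tnth_mktuple.
have k0 : (0 <= a ^+ d.+1)%R by rewrite exprn_ge0// ltW.
have [m mE] :=
  scaled_pushforward_measure (lebesgue_measure \x vol_measure d) k0 mf.
have h : (lebesgue_measure \x vol_measure d) B = m B.
  have := @product_measure_unique _ _ _ _ _ (@lebesgue_measure R) (vol_measure d) m.
  apply => // A1 A2 mA1 mA2.
  have mA1' : measurable ((fun x : measurableTypeR R => a * x + c)%R @^-1` A1).
    apply: measurable_preimage => //.
    by apply: measurable_funD => //; exact: measurable_funM.
  have mA2' : measurable (affine a t @^-1` A2).
    by apply: measurable_preimage => //; exact: measurable_affine.
  have E := product_measure1E lebesgue_measure (vol_measure d) mA1' mA2'.
  rewrite mE; transitivity ((a ^+ d.+1)%:E *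
      (lebesgue_measure ((fun x : measurableTypeR R => a * x + c)%R @^-1` A1) *
       vol_measure d (affine a t @^-1` A2))).
    by congr (_ * _); exact: E.
  rewrite lebesgue_measure_affine// IH// [X in _ * X]muleACA -EFinM -exprS !muleA -EFinM .
  by rewrite exprVn mulfV ?mul1e// expf_neq0// gt_eqF.
rewrite h mE muleA -EFinM exprVn mulVf ?mul1e//.
by rewrite expf_neq0// gt_eqF.
Qed.

End vol_affine.

(** * Measurability of inner products, norms and inequalities *)

Section measurable_dot.
Context {R : realType} {disp : measure_display} {T : measurableType disp}.
Implicit Types f g : T -> R.

Lemma measurable_dot d (f g : T -> d.-tuple R) :
  measurable_fun setT f -> measurable_fun setT g ->
  measurable_fun setT (fun t => dot (f t) (g t)).
Proof.
move=> mf mg; apply: measurable_sum => i.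
by apply: measurable_funM; apply: (measurableT_comp (measurable_tnth i)).
Qed.

Lemma measurable_enorm d (f : T -> d.-tuple R) :
  measurable_fun setT f -> measurable_fun setT (fun t => enorm (f t)).
Proof.
move=> mf.
rewrite (_ : (fun t => _) = (fun x => x `^ (2^-1)) \o (fun t => dot (f t) (f t))).
  by apply: measurableT_comp; [exact: measurable_powR|exact: measurable_dot].
by apply/funext => t /=; rewrite enormE powR12_sqrt// dot_ge0.
Qed.

Lemma measurable_set_le f g : measurable_fun setT f -> measurable_fun setT g ->
  measurable [set t | f t <= g t].
Proof.
by move=> mf mg; have := measurable_fun_ler mf mg measurableT (Y := [set true]) I;
  rewrite setTI.
Qed.

Lemma measurable_set_lt f g : measurable_fun setT f -> measurable_fun setT g ->
  measurable [set t | f t < g t].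
Proof.
by move=> mf mg; have := measurable_fun_ltr mf mg measurableT (Y := [set true]) I;
  rewrite setTI.
Qed.

End measurable_dot.

(** * Volumes of balls *)

Section ball_volume.
Context {R : realType} {d : nat}.
Implicit Types x y c u : d.-tuple R.
Local Notation mu := (@vol_measure R d).

Definition cball c (r : R) : set (d.-tuple R) :=
  [set y | dot (tsub y c) (tsub y c) <= r ^+ 2].

Lemma cball_affine c r : 0 < r ->
  cball c r = affine r^-1 (tscale (- r^-1) c) @^-1` unit_ball d.
Proof.
move=> r0; apply/funext => y; rewrite /cball /preimage /unit_ball/= enorm_le ?ler01// expr1n.
rewrite dot_tsubl !dot_tsubr dot_affinel !dot_affiner.
rewrite !(dot_tscalel, dot_tscaler) (dotC c y).
rewrite [in RHS](_ : _ + _ = (dot y y - dot y c - (dot y c - dot c c)) / r ^+ 2).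
  by rewrite ler_pdivrMr ?mul1r// exprn_gt0.
by field; rewrite gt_eqF.
Qed.

Lemma measurable_affineV a v (A : set (d.-tuple R)) :
  measurable A -> measurable (affine a v @^-1` A).
Proof. by apply: measurable_preimage; exact: measurable_affine. Qed.

Lemma measurable_unit_ball : measurable (@unit_ball R d).
Proof. by apply: measurable_set_le => //; exact: measurable_enorm. Qed.

Lemma measurable_cball c r : 0 < r -> measurable (cball c r).
Proof.
by move=> r0; rewrite cball_affine//; apply: measurable_affineV; exact: measurable_unit_ball.
Qed.

Lemma vol_cball c r : 0 < r ->
  mu (cball c r) = ((r ^+ d)%:E * mu (unit_ball d))%E.
Proof.
move=> r0; rewrite cball_affine// vol_affine ?invr_gt0// ?invrK//.
exact: measurable_unit_ball.
Qed.

Lemma measurable_box (A : 'I_d -> set R) : (forall i, measurable (A i)) ->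
  measurable [set x : d.-tuple R | forall i, A i (tnth x i)].
Proof.
move=> mA; rewrite (_ : mkset _ = \bigcap_(i in [set: 'I_d])
    ((fun x : d.-tuple R => tnth x i) @^-1` A i)).
  by apply: fin_bigcap_measurable => // i _; apply: measurable_preimage => //;
    exact: measurable_tnth.
by apply/seteqP; split => x /= H; [move=> i _|move=> i]; exact: H.
Qed.

Lemma vol_unit_ball_lty : (mu (unit_ball d) < +oo)%E.
Proof.
(* The ball lies in the cube of side 2. *)
pose A (i : 'I_d) : set R := `[-1, 1]%classic.
have mA i : measurable (A i) by exact: measurable_itv.
apply: (@le_lt_trans _ _ (mu [set x | forall i, A i (tnth x i)])).
  apply: le_measure; rewrite ?inE; first exact: measurable_unit_ball.
    exact: measurable_box.
  move=> x; rewrite /unit_ball/= enorm_le ?ler01// expr1n => x1 i.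
  rewrite /A /= in_itv/= -ler_norml -(@ler_pXn2r _ 2%N) ?nnegrE// expr1n.
  rewrite real_normK ?num_real// (le_trans _ x1)// /dot (bigD1 i)//= expr2.
  by rewrite lerDl sumr_ge0// => j _; rewrite -expr2 sqr_ge0.
rewrite vol_measureE vol_box// (eq_bigr (fun=> 2%:E)) => [|i _].
  by rewrite prodEFin ltry.
rewrite lebesgue_measure_itv/= lte_fin; case: ifPn => [_|/negP]; last by case; lra.
by rewrite -EFinB; congr EFin; lra.
Qed.

Lemma vol_unit_ball_gt0 : (0 < mu (unit_ball d))%E.
Proof.
(* The ball contains the cube [[0, e]^d], as [d * e <= 1]; taking [d.+1] keeps [e] positive for
   [d = 0]. *)
pose e : R := d.+1%:R^-1.
have e0 : 0 < e by rewrite invr_gt0 ltr0n.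
pose A (i : 'I_d) : set R := `[0, e]%classic.
have mA i : measurable (A i) by exact: measurable_itv.
apply: (@lt_le_trans _ _ (mu [set x | forall i, A i (tnth x i)])).
  rewrite vol_measureE vol_box// (eq_bigr (fun=> e%:E)) => [|i _].
    by rewrite prodEFin lte_fin prodr_gt0.
  by rewrite lebesgue_measure_itv/= lte_fin e0 sube0.
apply: le_measure; rewrite ?inE; [exact: measurable_box|exact: measurable_unit_ball|].
move=> x /= xA; rewrite /unit_ball/= enorm_le ?ler01// expr1n.
apply: (@le_trans _ _ (\sum_(i < d) e)).
  apply: ler_sum => i _; have := xA i; rewrite /A /= in_itv/= => /andP[x0 xe].
  rewrite -[leRHS]mulr1 ler_pM// (le_trans xe)// invf_le1 ?ltr0n//.
  by rewrite ler1n.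
rewrite sumr_const card_ord -mulr_natl /e ler_pdivrMr ?ltr0n// mul1r.
by rewrite ler_nat.
Qed.

Lemma vol_unit_ball_fin : mu (unit_ball d) \is a fin_num.
Proof. by rewrite ge0_fin_numE ?measure_ge0// vol_unit_ball_lty. Qed.

End ball_volume.

(** * Upper and lower bounds for the volume of a cone *)

Section cone_volume.
Context {R : realType} {d : nat}.
Implicit Types x y u z : d.-tuple R.
Local Notation mu := (@vol_measure R d).

(** The cone over the cap of unit vectors that cut off [x], matching the cone form of
    [sphere_uniform]. The strict inequality excludes the apex 0. *)
Definition cone x : set (d.-tuple R) :=
  [set y | enorm y <= 1 /\ enorm y / 2 < dot x y].

Lemma measurable_cone x : measurable (cone x).
Proof.
apply: measurableI; first exact: measurable_unit_ball.
apply: measurable_set_lt; last exact: measurable_dot.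
by apply: measurable_funM => //; exact: measurable_enorm.
Qed.

Lemma vol_cone_le x : (mu (cone x) <= mu (unit_ball d))%E.
Proof.
apply: le_measure; rewrite ?inE; [exact: measurable_cone|exact: measurable_unit_ball|].
by move=> y [].
Qed.

Lemma vol_cone_fin x : mu (cone x) \is a fin_num.
Proof.
by rewrite ge0_fin_numE ?measure_ge0// (le_lt_trans (vol_cone_le x))// vol_unit_ball_lty.
Qed.

(* By homogeneity the cone is controlled by its part in the thin shell
   [1 - e <= |y| <= 1], which lies in a ball of radius [q] centred on the axis. *)
Lemma vol_cone_upper x (r e q : R) : (0 < d)%N -> 1 / 2 <= r -> 0 < e < 1 ->
  0 < q -> 1 - (4 * r ^+ 2)^-1 + e ^+ 2 <= q ^+ 2 -> enorm x <= r ->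
  (e%:E * mu (cone x) <= (q ^+ d)%:E * mu (unit_ball d))%E.
Proof.
move=> d0 r2 /andP[e0 e1] q0 hq xr.
have r0 : 0 < r by lra.
have e10 : 0 < 1 - e by lra.
(* For [|y| = 1] and [<x, y> > 1/2] one has [|y - c x|^2 <= 1 - c + c^2 r^2]; this [c] minimises the
   bound, with value [1 - (4 r^2)^-1]. *)
pose c := (2 * r ^+ 2)^-1.
(* The copy of the cone shrunk by [1 - e], which holds all its points of norm at most [1 - e]. *)
pose S := affine (1 - e)^-1 (tscale 0 x) @^-1` cone x.
have mS : measurable S by apply: measurable_affineV; exact: measurable_cone.
have mB : measurable (cball (tscale c x) q) by exact: measurable_cball.
have sub : cone x `<=` S `|` cball (tscale c x) q.
  move=> y [y1 yx].
  have [ye|ye] := leP (enorm y) (1 - e); [left|right].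
    rewrite /S /cone/=.
    have -> : enorm (affine (1 - e)^-1 (tscale 0 x) y) = (1 - e)^-1 * enorm y.
      rewrite !enormE dot_affinel !dot_affiner !dot_tscaler !dot_tscalel.
      rewrite !(mul0r, mulr0, addr0) mulrA -expr2 sqrtrM ?sqr_ge0// sqrtr_sqr ger0_norm//.
      by rewrite invr_ge0 ltW.
    rewrite dot_affiner dot_tscaler mul0r addr0 -mulrA ltr_pM2l ?invr_gt0//.
    by split=> //; rewrite mulrC ler_pdivrMr// mul1r.
  rewrite /cball/= (le_trans _ hq)//.
  rewrite dot_tsubl !dot_tsubr !(dot_tscalel, dot_tscaler) (dotC y x).
  have xr2 : dot x x <= r ^+ 2 by rewrite -enorm_le// ltW.
  rewrite -enorm_sqr; set s := enorm y in y1 yx ye *.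
  set T := (4 * r ^+ 2)^-1.
  have T0 : 0 < T by rewrite invr_gt0 mulr_gt0// exprn_gt0.
  have T1 : T <= 1.
    by rewrite invf_le1 ?mulr_gt0 ?exprn_gt0//; nra.
  have cT : c = 2 * T by rewrite /c /T; field; rewrite gt_eqF.
  have h1 : c * s <= 2 * c * dot x y.
    by rewrite -mulrA mulrCA -subr_ge0 -mulrBr mulr_ge0 ?invr_ge0; nra.
  have h2 : c * (c * dot x x) <= T.
    apply: (@le_trans _ _ (c * (c * r ^+ 2))).
      by rewrite !ler_pM2l// invr_gt0 mulr_gt0// exprn_gt0.
    by rewrite le_eqVlt; apply/orP; left; apply/eqP; rewrite /c /T; field; rewrite gt_eqF.
  by rewrite cT in h1 h2 *; nra.
have := vol_cone_le x; have := vol_cone_fin x.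
have : (mu (cone x) <= ((1 - e) ^+ d)%:E * mu (cone x) + (q ^+ d)%:E * mu (unit_ball d))%E.
  have <- : mu S = (((1 - e) ^+ d)%:E * mu (cone x))%E.
    by rewrite vol_affine ?invr_gt0// ?invrK//; exact: measurable_cone.
  rewrite -(vol_cball (tscale c x))//.
  apply: (le_trans _ (measureU2 _ mS mB)).
  by apply: le_measure; rewrite ?inE//; [exact: measurable_cone|exact: measurableU].
move=> + /fineK hK; rewrite -hK -(fineK (@vol_unit_ball_fin R d)).
rewrite -!EFinM -EFinD !lee_fin; set k := fine _; set b := fine _ => h kb.
have k0 : 0 <= k by apply: fine_ge0; exact: measure_ge0.
(* As [d > 0], the shrunk copy has at most the fraction [1 - e] of the cone; moving it to the left
   leaves the factor [e]. *)
have : (1 - e) ^+ d <= 1 - e.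
  by case: d d0 => // d' _; rewrite exprS ler_piMr ?(ltW e10)// exprn_ile1 ?(ltW e10)//; lra.
by move=> /(ler_wpM2r k0); lra.
Qed.

Definition slab u (rho h : R) : set (d.-tuple R) :=
  [set z | dot z z <= rho ^+ 2 /\ `|dot u z| <= h].

Lemma measurable_slab u rho h : measurable (slab u rho h).
Proof.
apply: measurableI; first by apply: measurable_set_le => //; exact: measurable_dot.
apply: measurable_set_le => //; apply: measurableT_comp => //.
exact: measurable_dot.
Qed.

Lemma dot_affine1_tscale u z (a : R) : dot u u = 1 ->
  dot (affine 1 (tscale a u) z) (affine 1 (tscale a u) z) =
  dot z z + 2 * a * dot u z + a ^+ 2.
Proof.
move=> u1; rewrite dot_affinel !dot_affiner !(dot_tscalel, dot_tscaler) u1.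
by rewrite (dotC z u); ring.
Qed.

(* Cutting the ball orthogonally to [u] into slices of width [h], each slice
   moves into the central slab by a translation along [u]. *)
Lemma vol_slab u (rho h : R) (N : nat) : dot u u = 1 -> 0 < rho -> 0 < h ->
  rho < N%:R * h ->
  ((rho ^+ d)%:E * mu (unit_ball d) <= (2 * N)%:R%:E * mu (slab u rho h))%E.
Proof.
move=> u1 rho0 h0 rhoN.
pose F (k : nat) := (affine 1 (tscale (- (k%:R * h)) u) @^-1` slab u rho h) `|`
  (affine 1 (tscale (k%:R * h) u) @^-1` slab u rho h).
have mF k : measurable (F k).
  by apply: measurableU; apply: measurable_affineV; exact: measurable_slab.
have sub : cball (tscale 0 u) rho `<=` \big[setU/set0]_(k < N) F k.
  move=> z; rewrite /cball /= dot_tsubl !dot_tsubr !(dot_tscalel, dot_tscaler).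
  rewrite !mul0r !subr0 => zz.
  have un : enorm u = 1 by rewrite enormE u1 sqrtr1.
  have zrho : enorm z <= rho by rewrite enorm_le// ltW.
  have uz : `|dot u z| <= rho.
    by rewrite (le_trans (normr_dot_le _ _))// un mul1r.
  (* Moving [z] by [k * h] towards the hyperplane orthogonal to [u] brings [|<u, z>|] below [h];
     since [k * h <= |<u, z>|], the norm does not grow. *)
  pose k := Num.truncn (`|dot u z| / h).
  have /andP[k1 k2] : k%:R <= `|dot u z| / h < k.+1%:R.
    by apply: truncn_itv; rewrite divr_ge0// ltW.
  rewrite ler_pdivlMr// in k1; rewrite ltr_pdivrMr// -natr1 in k2.
  have kN : (k < N)%N.
    rewrite -(ltr_nat R) -(ltr_pM2r h0).
    by rewrite (le_lt_trans k1)// (le_lt_trans uz).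
  rewrite -bigcup_mkord; exists k => //=.
  have kh0 : 0 <= k%:R * h by rewrite mulr_ge0// ltW.
  have [s0|s0] := leP 0 (dot u z); [left|right].
    rewrite ger0_norm// in k1 k2.
    rewrite /slab/= dot_affine1_tscale// dot_affiner dot_tscaler u1; split.
      by apply: (le_trans _ zz); nra.
    by rewrite ler_norml; apply/andP; split; lra.
  rewrite ltr0_norm// in k1 k2.
  rewrite /slab/= dot_affine1_tscale// dot_affiner dot_tscaler u1; split.
    by apply: (le_trans _ zz); nra.
  by rewrite ler_norml; apply/andP; split; lra.
rewrite -(vol_cball (tscale 0 u))//.
have := @content_subadditive _ _ _ mu _ _ _ (fun k _ => mF k)
  (measurable_cball (tscale 0 u) rho0) sub.
move=> /le_trans; apply.
apply: (@le_trans _ _ (\sum_(k < N) (2%:E * mu (slab u rho h)))%E).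
  apply: lee_sum => k _.
  have mA a : measurable (affine 1 (tscale a u) @^-1` slab u rho h).
    by apply: measurable_affineV; exact: measurable_slab.
  have vA a : mu (affine 1 (tscale a u) @^-1` slab u rho h) = mu (slab u rho h).
    by rewrite vol_affine ?invr1 ?expr1n ?mul1e//; exact: measurable_slab.
  rewrite mule_natl mule2n -{1}(vA (- (k%:R * h))) -(vA (k%:R * h)).
  exact: measureU2.
by rewrite -ge0_sume_distrl// sumEFin sumr_const card_ord -mulrnA.
Qed.

(** The central slab, translated by [t] along the axis [u = x / |x|], fits into the cone: its points
    [y] satisfy [|y|^2 <= t^2 + 2 t h + rho^2 <= 1] and [<x, y> >= r (t - h) > 1/2]. Then [vol_slab]
    applies. *)
Lemma vol_cone_lower x (r t rho h : R) (N : nat) : 0 < r -> r <= enorm x ->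
  0 < rho -> 0 < h -> 0 <= t -> t ^+ 2 + 2 * t * h + rho ^+ 2 <= 1 ->
  1 / 2 < r * (t - h) -> rho < N%:R * h ->
  ((rho ^+ d)%:E * mu (unit_ball d) <= (2 * N)%:R%:E * mu (cone x))%E.
Proof.
move=> r0 rx rho0 h0 t0 sq rth rhoN.
have x0 : 0 < enorm x by lra.
pose u := tscale (enorm x)^-1 x.
have u1 : dot u u = 1.
  by rewrite dot_tscalel dot_tscaler -enorm_sqr; field; rewrite gt_eqF.
apply: (le_trans (vol_slab u1 rho0 h0 rhoN)); apply: lee_pmul => //.
have <- : mu (affine 1 (tscale (- t) u) @^-1` slab u rho h) = mu (slab u rho h).
  by rewrite vol_affine ?invr1 ?expr1n ?mul1e//; exact: measurable_slab.
apply: le_measure; rewrite ?inE.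
- by apply: measurable_affineV; exact: measurable_slab.
- exact: measurable_cone.
move=> y; rewrite /slab/= dot_affine1_tscale// dot_affiner dot_tscaler u1.
rewrite ler_norml => -[yy /andP[uy1 uy2]].
have y1 : enorm y <= 1 by rewrite enorm_le// expr1n; nra.
split => //.
have -> : dot x y = enorm x * dot u y.
  by rewrite dot_tscalel mulrA mulfV ?mul1r// gt_eqF.
have : r * (t - h) <= enorm x * dot u y.
  by apply: ler_pM => //; nra.
lra.
Qed.

End cone_volume.

(** * Union bound and Markov's inequality for random sections *)

Lemma measure_bigsetU_le (R : realType) (disp : measure_display)
    (T : measurableType disp) (mu : {measure set T -> \bar R}) (I : Type)
    (s : seq I) (F : I -> set T) : (forall i, measurable (F i)) ->
  (mu (\big[setU/set0]_(i <- s) F i) <= \sum_(i <- s) mu (F i))%E.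
Proof.
move=> mF; elim: s => [|i s IH]; first by rewrite !big_nil measure0.
rewrite !big_cons; apply: (@le_trans _ _ (mu (F i) +
    mu (\big[setU/set0]_(i <- s) F i))%E); last exact: leeD2l.
by apply: measureU2 => //; exact: bigsetU_measurable.
Qed.

Section markov_section.
Context {R : realType} {disp1 disp2 : measure_display}
  {T : measurableType disp1} {U : measurableType disp2}.
Local Open Scope ereal_scope.

(** By Tonelli the expectation of [mu (xsection S w)] is the integral over [x] of
    [P (ysection S x)], which is at most [p] on [D] and 0 elsewhere. Markov's inequality
    finishes. *)
Lemma markov_section (P : probability T R)
    (mu : {sigma_finite_measure set U -> \bar R}) (S : set (T * U)) (D : set U)
    (p a : R) :
  measurable S -> measurable D -> (forall w x, S (w, x) -> D x) ->
  (forall x, D x -> P (ysection S x) <= p%:E) -> (0 < a)%R ->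
  a%:E * P [set w | a%:E <= mu (xsection S w)] <= p%:E * mu D.
Proof.
move=> mS mD SD Pp a0.
have mf : measurable_fun setT (mu \o xsection S) by exact: measurable_fun_xsection.
have := @le_integral_comp_abse _ _ _ P _ measurableT (mu \o xsection S) a id
  (@measurable_id _ _ _) (fun _ => id) (fun _ _ _ _ => id) mf a0.
rewrite setTI => markov_le.
rewrite (_ : [set w | _] = [set x | a%:E <= `|(mu \o xsection S) x|]); last first.
  by apply/funext => w /=; rewrite gee0_abs// measure_ge0.
apply: (le_trans markov_le).
rewrite (eq_integral (mu \o xsection S)); last first.
  by move=> w _; rewrite gee0_abs// measure_ge0.
have := indic_fubini_tonelli P mu mS.
rewrite indic_fubini_tonelli_FE// indic_fubini_tonelli_GE// => ->.
rewrite -integral_cst// [in leRHS]integral_mkcond.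
apply: ge0_le_integral => //.
- exact: measurable_fun_ysection.
- by apply/(measurable_restrictT _ mD).
move=> x _; rewrite patchE/=; case: ifPn => [/set_mem Dx|/negP nDx].
  exact: Pp.
rewrite (_ : ysection S x = set0) ?measure0//.
rewrite -subset0 => w; rewrite /ysection/= => /set_mem /SD Dx.
by apply: nDx; rewrite inE.
Qed.

End markov_section.

(** * Tail bounds for the random cell in a fixed dimension *)

Section random_voronoi.
Context {R : realType} {disp : measure_display} {T : measurableType disp}.
Context {P : probability T R} {d n : nat}.
Context {X : 'I_n -> {RV P >-> (d.-tuple R)%type}}.
Hypothesis d_gt0 : (0 < d)%N.
Hypothesis X_indep : independent_RVs X.
Hypothesis X_unif : forall (i : 'I_n) (A : set (d.-tuple R)),
  measurable A -> distribution P (X i) A = sphere_uniform A.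
Local Notation mu := (@vol_measure R d).
Local Notation V w := (voronoi (range (fun i : 'I_n => X i w))).

Lemma voronoiE w x : V w x <-> forall i, half_space (X i w) x.
Proof.
by split => [h i|h v [i _ <-]]; [apply: h; exists i|exact: h].
Qed.

Lemma measurable_half_space_graph i :
  measurable [set p : T * d.-tuple R | half_space (X i p.1) p.2].
Proof.
rewrite (_ : mkset _ = [set p : T * d.-tuple R |
    dot p.2 (X i p.1) <= dot (X i p.1) (X i p.1) * 2^-1]); last first.
  by apply/seteqP; split => p /=; rewrite half_spaceE.
have mX : measurable_fun setT (fun p : T * d.-tuple R => X i p.1).
  by apply: measurableT_comp.
apply: measurable_set_le; first exact: measurable_dot.
by apply: measurable_funM => //; exact: measurable_dot.
Qed.

(** Joint measurability in the sample and the point yields both measurable cells and the use of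
    Tonelli. *)
Lemma measurable_voronoi_graph :
  measurable [set p : T * d.-tuple R | V p.1 p.2].
Proof.
rewrite (_ : mkset _ = \bigcap_(i in [set: 'I_n])
   [set p : T * d.-tuple R | half_space (X i p.1) p.2]).
  by apply: fin_bigcap_measurable => // i _; exact: measurable_half_space_graph.
apply/seteqP; split => p /=; first by move=> /voronoiE h i _; exact: h.
by move=> h; apply/voronoiE => i; exact: h.
Qed.

Lemma measurable_voronoi w : measurable (V w).
Proof.
have := measurable_xsection w measurable_voronoi_graph; congr measurable.
by apply/seteqP; split => x; rewrite /xsection/= inE.
Qed.

Lemma measurable_vol_voronoi : measurable_fun setT (fun w => mu (V w)).
Proof.
have := measurable_fun_xsection mu measurable_voronoi_graph.
congr measurable_fun; apply/funext => w /=; congr (mu _).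
by apply/seteqP; split => x; rewrite /xsection/= inE.
Qed.

Lemma measurable_half_space_centers x :
  measurable [set v : d.-tuple R | half_space v x].
Proof.
rewrite (_ : mkset _ = [set v | dot x v <= dot v v * 2^-1]).
  apply: measurable_set_le; first exact: measurable_dot.
  by apply: measurable_funM => //; exact: measurable_dot.
by apply/seteqP; split => v /=; rewrite half_spaceE.
Qed.

(** A unit vector [s] cuts off [x] exactly when [<x, s> > 1/2], and a point [y] of the cone is
    nonzero, so it is [|y|] times its direction. *)
Lemma cone_over_cap x :
  [set tscale r s | r in `]0%R, 1%R] &
     s in unit_sphere d `&` ~` [set v : d.-tuple R | half_space v x]] = cone x.
Proof.
apply/seteqP; split => [_ [r + [s [s1]] hs <-]|y [y1 yx]].
  rewrite /= in_itv/= => /andP[r0 r1].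
  have ss : dot s s = 1 by rewrite -enorm_sqr s1 expr1n.
  have {}hs : 1 / 2 < dot x s.
    by rewrite ltNge; apply/negP => h; apply: hs; rewrite /= half_spaceE ss.
  have -> : cone x (tscale r s) = (r <= 1 /\ r / 2 < r * dot x s).
    rewrite /cone/= (_ : enorm (tscale r s) = r) ?dot_tscaler//.
    by rewrite enormE dot_tscalel dot_tscaler ss mulr1 -expr2 sqrtr_sqr gtr0_norm.
  by split=> //; rewrite ltr_pM2l//; lra.
have y0 : 0 < enorm y.
  rewrite lt_neqAle enorm_ge0 andbT eq_sym; apply/eqP => y0.
  by move: yx; rewrite dotC enorm_eq0_dot// y0 mul0r ltxx.
exists (enorm y); first by rewrite /= in_itv/= y0.
have yy : tscale (enorm y) (tscale (enorm y)^-1 y) = y.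
  by apply: eq_from_tnth => i; rewrite !tnth_mktuple mulrA mulfV ?mul1r// gt_eqF.
exists (tscale (enorm y)^-1 y) => //.
have ss : dot (tscale (enorm y)^-1 y) (tscale (enorm y)^-1 y) = 1.
  by rewrite dot_tscalel dot_tscaler -enorm_sqr; field; rewrite gt_eqF.
split; first by rewrite /unit_sphere/= enormE ss sqrtr1.
rewrite /= half_spaceE ss dot_tscaler; apply/negP; rewrite -ltNge.
by rewrite mul1r mulrC ltr_pdivlMr// mulrC.
Qed.

(** The probability that one random vector cuts off [x], see [probability_cap]. *)
Definition cap_mass x : R := fine (mu (cone x)) / fine (mu (unit_ball d)).

Lemma vol_unit_ball_fine_gt0 : 0 < fine (mu (unit_ball d)).
Proof. by rewrite fine_gt0// vol_unit_ball_gt0 vol_unit_ball_lty. Qed.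

Lemma probability_cap i x :
  P (X i @^-1` (~` [set v | half_space v x])) = (cap_mass x)%:E.
Proof.
have := X_unif i (measurableC (measurable_half_space_centers x)).
rewrite /distribution /pushforward => ->.
rewrite /sphere_uniform cone_over_cap -vol_measureE.
rewrite -(fineK (vol_cone_fin x)) -(fineK (@vol_unit_ball_fin R d)).
by rewrite inver gt_eqF ?vol_unit_ball_fine_gt0.
Qed.

Lemma measurable_RV_preimage i A : measurable A -> measurable (X i @^-1` A).
Proof. by apply: measurable_preimage. Qed.

Lemma probability_half_space i x :
  P (X i @^-1` [set v | half_space v x]) = (1 - cap_mass x)%:E.
Proof.
have mC := measurable_RV_preimage i (measurable_half_space_centers x).
have := probability_cap i x; rewrite preimage_setC probability_setC//.
rewrite -(fineK (fin_num_measure P _ mC)) -EFinB => -[<-].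
by congr EFin; lra.
Qed.

Lemma probability_in_voronoi x :
  P [set w | V w x] = ((1 - cap_mass x) ^+ n)%:E.
Proof.
have := X_indep [set: 'I_n]%SET (fun=> measurable_half_space_centers x).
rewrite (eq_bigr (fun=> (1 - cap_mass x)%:E)); last first.
  by move=> i _; rewrite probability_half_space.
rewrite prodEFin prodr_const cardsT card_ord => <-; congr (P _).
apply/seteqP; split => w /=; first by move=> /voronoiE h i _; exact: h.
by move=> h; apply/voronoiE => i; apply: h; rewrite /= inE.
Qed.

Lemma probability_notin_voronoi_le x :
  (P [set w | ~ V w x] <= (n%:R * cap_mass x)%:E)%E.
Proof.
have mA i : measurable (X i @^-1` (~` [set v | half_space v x])).
  by apply: measurable_RV_preimage; apply: measurableC; exact: measurable_half_space_centers.
rewrite (_ : mkset _ = \big[setU/set0]_(i < n)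
   (X i @^-1` (~` [set v | half_space v x]))); last first.
  rewrite -bigcup_seq; apply/seteqP; split => w /=.
    move=> nV; have /existsNP[i hi] : ~ forall i, half_space (X i w) x.
      by move=> h; apply/nV/voronoiE.
    by exists i => //=; rewrite mem_index_enum.
  by move=> [i _ hi] /voronoiE h; apply: hi; exact: h.
apply: (le_trans (measure_bigsetU_le P _ mA)).
rewrite (eq_bigr (fun=> (cap_mass x)%:E)); last by move=> i _; exact: probability_cap.
by rewrite sumEFin sumr_const card_ord mulr_natl.
Qed.

(** The cone over the empty part of the sphere is empty, so each vector misses the sphere with
    probability 0. The geometric argument for the upper tail needs unit vectors. *)
Lemma off_sphere_null : P [set w | exists i, enorm (X i w) != 1] = 0%E.
Proof.
have mS : measurable (~` (unit_sphere d : set (d.-tuple R))).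
  apply: measurableC; rewrite (_ : unit_sphere d =
    (fun x : d.-tuple R => enorm x) @^-1` [set 1])//.
  by apply: measurable_preimage => //; exact: measurable_enorm.
have mA i : measurable (X i @^-1` (~` unit_sphere d)).
  exact: measurable_RV_preimage.
rewrite (_ : mkset _ = \big[setU/set0]_(i < n) (X i @^-1` (~` unit_sphere d))).
  apply/eqP; rewrite eq_le measure_ge0 andbT.
  apply: (le_trans (measure_bigsetU_le P _ mA)).
  rewrite big1// => i _; apply: (etrans (X_unif i mS)).
  rewrite /sphere_uniform setICr -vol_measureE (_ : image2 _ _ _ = set0).
    by rewrite measure0 mul0e.
  by rewrite -subset0 => y [? _ [? []]].
rewrite -bigcup_seq; apply/seteqP; split => w /=.
  by move=> [i /eqP hi]; exists i => //=; rewrite mem_index_enum.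
by move=> [i _ hi]; exists i; apply/eqP.
Qed.

Lemma cap_mass_upper x (r e q : R) : 1 / 2 <= r -> 0 < e < 1 ->
  0 < q -> 1 - (4 * r ^+ 2)^-1 + e ^+ 2 <= q ^+ 2 -> enorm x <= r ->
  cap_mass x <= q ^+ d / e.
Proof.
move=> r2 e01 q0 hq xr; have := vol_cone_upper d_gt0 r2 e01 q0 hq xr.
rewrite /cap_mass -{1}(fineK (vol_cone_fin x)) -{1}(fineK (@vol_unit_ball_fin R d)).
rewrite -!EFinM lee_fin => h; case/andP: e01 => e0 _.
rewrite ler_pdivrMr ?vol_unit_ball_fine_gt0//.
by rewrite mulrAC ler_pdivlMr// mulrC.
Qed.

Lemma cap_mass_lower x (r t rho h : R) (N : nat) : 0 < r -> r <= enorm x ->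
  0 < rho -> 0 < h -> 0 <= t -> t ^+ 2 + 2 * t * h + rho ^+ 2 <= 1 ->
  1 / 2 < r * (t - h) -> rho < N%:R * h ->
  rho ^+ d / (2 * N)%:R <= cap_mass x.
Proof.
move=> r0 rx rho0 h0 t0 sq rth rhoN.
have := vol_cone_lower r0 rx rho0 h0 t0 sq rth rhoN.
rewrite /cap_mass -{1}(fineK (vol_cone_fin x)) -{1}(fineK (@vol_unit_ball_fin R d)).
rewrite -!EFinM lee_fin => hh.
have N0 : 0 < (2 * N)%:R :> R.
  rewrite ltr0n muln_gt0/=; case: N rhoN {hh} => // /(lt_trans rho0).
  by rewrite mul0r ltxx.
rewrite ler_pdivlMr ?vol_unit_ball_fine_gt0//.
by rewrite mulrAC ler_pdivrMr// [leRHS]mulrC.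
Qed.

Lemma measurable_enorm_ball (r : R) : measurable [set x : d.-tuple R | enorm x <= r].
Proof. by apply: measurable_set_le => //; exact: measurable_enorm. Qed.

Lemma vol_enorm_ball (r : R) : 0 < r ->
  mu [set x | enorm x <= r] = (r ^+ d * fine (mu (unit_ball d)))%:E.
Proof.
move=> r0; rewrite EFinM fineK ?vol_unit_ball_fin//.
rewrite -(vol_cball (tscale 0 [tuple of nseq d 0]))//; congr (mu _).
apply/funext => x; rewrite /cball/= dot_tsubl !dot_tsubr.
by rewrite !(dot_tscalel, dot_tscaler) !mul0r !subr0 enorm_le// ltW.
Qed.

(** Each point of the ball of radius [r] is outside the cell with probability at most [n * p]. If
    the cell has less than half the volume of that ball, the part of the ball outside it has at
    least half; Markov at this threshold gives the factor 2. *)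
Lemma vol_voronoi_lower_tail (r p : R) : 0 < r ->
  (forall x, enorm x <= r -> cap_mass x <= p) ->
  (P [set w | (mu (V w) < (r ^+ d / 2 * fine (mu (unit_ball d)))%:E)%E]
    <= (2 * n%:R * p)%:E)%E.
Proof.
move=> r0 capp; set b := fine _.
have b0 : 0 < b := vol_unit_ball_fine_gt0.
pose D : set (d.-tuple R) := [set x | enorm x <= r].
pose S := [set q : T * d.-tuple R | D q.2] `\` [set q : T * d.-tuple R | V q.1 q.2].
have mD : measurable D := measurable_enorm_ball r.
have mS : measurable S.
  apply: measurableD; last exact: measurable_voronoi_graph.
  by apply: (@measurable_preimage _ _ _ _ snd).
have SE w : xsection S w = D `\` V w.
  by apply/seteqP; split => x; rewrite /xsection/= inE.
pose a := r ^+ d / 2 * b.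
have a0 : 0 < a by rewrite mulr_gt0// divr_gt0// exprn_gt0.
have := @markov_section _ _ _ _ _ P mu S D (n%:R * p) a mS mD.
move=> /(_ (fun w x => @proj1 _ _)) h.
have {}h : (a%:E * P [set w | a%:E <= mu (xsection S w)] <=
            (n%:R * p)%:E * mu D)%E.
  apply: h => // x Dx; apply: (@le_trans _ _ (P [set w | ~ V w x])).
    rewrite (_ : ysection S x = [set w | ~ V w x])//.
    by apply/seteqP; split => w; rewrite /ysection/= inE; [case|split].
  apply: (le_trans (probability_notin_voronoi_le x)).
  by rewrite lee_fin ler_wpM2l// capp.
have mE : measurable [set w | (a%:E <= mu (xsection S w))%E].
  rewrite -[X in measurable X]setTI.
  by apply: emeasurable_fun_c_infty => //; exact: measurable_fun_xsection.
apply: (@le_trans _ _ (P [set w | (a%:E <= mu (xsection S w))%E])).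
  apply: le_measure; rewrite ?inE//.
    rewrite -[X in measurable X]setTI.
    by apply: emeasurable_fun_infty_o => //; exact: measurable_vol_voronoi.
  move=> w /= Va; rewrite leNgt; apply/negP => Sa.
  have : (mu D <= mu (xsection S w) + mu (V w))%E.
    rewrite SE; apply: (@le_trans _ _ (mu ((D `\` V w) `|` V w))).
      apply: le_measure; rewrite ?inE//.
        by apply: measurableU; [apply: measurableD => //|]; exact: measurable_voronoi.
      by move=> x Dx; have [?|?] := pselect (V w x); [right|left].
    by apply: measureU2; [apply: measurableD => //|]; exact: measurable_voronoi.
  apply/negP; rewrite -ltNge (lt_le_trans (lteD Sa Va))//.
  rewrite vol_enorm_ball// -EFinD lee_fin -/b /a.
  by rewrite le_eqVlt; apply/orP; left; apply/eqP; field.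
rewrite vol_enorm_ball// -/b in h.
rewrite -(fineK (fin_num_measure P _ mE)) -!EFinM !lee_fin in h *.
rewrite -(ler_pM2l a0) (le_trans h)// le_eqVlt; apply/orP; left; apply/eqP.
by rewrite /a; field.
Qed.

(** The centre [k x] lies on the segment from 0 to [x], at norm [m] halfway through the shell. As
    [<x, v> <= 1/2], it satisfies [<k x, v> <= k / 2], which leaves slack [(1 - k) / 2] in every
    half space. The first bound on [rho] keeps the ball in the shell, the second puts [rho] below
    the slack. *)
Lemma voronoi_contains_ball w x (r1 r2 rho : R) :
  (forall i, enorm (X i w) = 1) -> V w x -> 0 < r1 -> r1 < r2 -> r2 < enorm x ->
  rho <= (r2 - r1) / 2 -> rho <= (r2 - r1) / (4 * r2) -> 0 < rho ->
  cball (tscale ((r1 + r2) / 2 / enorm x) x) rho `<=`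
    [set y | r1 <= enorm y <= r2] `&` V w.
Proof.
move=> X1 /voronoiE Vx r1p r12 r2x rho1 rho2 rho0.
set m := (r1 + r2) / 2; set k := m / enorm x.
have r2p : 0 < r2 by lra.
have x0 : 0 < enorm x by lra.
have kx : k * enorm x = m by rewrite divfK// gt_eqF.
have k1 : k * r2 <= m by rewrite -kx ler_pM2l ?divr_gt0 ?ltW//; rewrite /m; lra.
have rhok : rho <= (1 - k) / 2.
  rewrite (le_trans rho2)// ler_pdivrMr ?mulr_gt0//; rewrite /m in k1; nra.
move=> y yk; set z := tsub y (tscale k x).
have zrho : enorm z <= rho by rewrite enorm_le ?(ltW rho0).
have yE v : dot y v = k * dot x v + dot z v.
  by rewrite /z dot_tsubl dot_tscalel; ring.
have z0 := enorm_ge0 z.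
have yy : dot y y = m ^+ 2 + 2 * (k * dot x z) + enorm z ^+ 2.
  rewrite enorm_sqr yE (dotC x) (dotC z) !yE (dotC z x) -enorm_sqr.
  by rewrite -kx; ring.
have : `|k * dot x z| <= m * enorm z.
  have k0 : 0 <= k by rewrite divr_ge0 ?enorm_ge0// /m; lra.
  by rewrite normrM ger0_norm// -kx -mulrA ler_wpM2l// normr_dot_le.
rewrite ler_norml => /andP[h1 h2].
have m12 : r1 + rho <= m <= r2 - rho by apply/andP; split; rewrite /m; lra.
case/andP: m12 => m1 m2; split; last first.
  apply/voronoiE => i; apply/half_spaceE.
  have := Vx i; rewrite half_spaceE -!enorm_sqr X1 expr1n => xv.
  have zv : dot z (X i w) <= rho.
    by rewrite (le_trans (dot_le_enorm _ _))// X1 mulr1.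
  have k0 : 0 <= k by rewrite divr_ge0 ?enorm_ge0// /m; lra.
  rewrite yE; have := ler_wpM2l k0 xv; lra.
rewrite /= enorm_ge ?enorm_le ?(ltW r1p) ?(ltW r2p)// yy.
by apply/andP; split; nra.
Qed.

(** A cell of larger volume than the ball of radius [r2] leaves that ball, so it contains a ball of
    radius [rho] inside the shell. A shell point survives with probability at most
    [(1 - c)^n <= expR (- (n * c))], and Markov with threshold [rho ^+ d * b] gives the ratio
    [(r2 / rho) ^+ d]. *)
Lemma vol_voronoi_upper_tail (r1 r2 c rho : R) : 0 < r1 -> r1 < r2 ->
  rho <= (r2 - r1) / 2 -> rho <= (r2 - r1) / (4 * r2) -> 0 < rho ->
  (forall x : d.-tuple R, r1 <= enorm x -> c <= cap_mass x) ->
  (P [set w | ((r2 ^+ d * fine (mu (unit_ball d)))%:E < mu (V w))%E]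
    <= (expR (- (n%:R * c)) * (r2 / rho) ^+ d)%:E)%E.
Proof.
move=> r1p r12 rho1 rho2 rho0 capc; set b := fine _.
have r2p : 0 < r2 by lra.
have b0 : 0 < b := vol_unit_ball_fine_gt0.
pose D : set (d.-tuple R) := [set x | r1 <= enorm x <= r2].
have mD : measurable D.
  rewrite (_ : D = [set x | r1 <= enorm x] `&` [set x | enorm x <= r2]).
    by apply: measurableI; apply: measurable_set_le => //; exact: measurable_enorm.
  by apply/seteqP; split => x /=; [move=> /andP[]|move=> [? ?]; apply/andP].
pose S := [set q : T * d.-tuple R | D q.2] `&` [set q : T * d.-tuple R | V q.1 q.2].
have mS : measurable S.
  apply: measurableI; last exact: measurable_voronoi_graph.
  by apply: (@measurable_preimage _ _ _ _ snd).
have SE w : xsection S w = D `&` V w.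
  by apply/seteqP; split => x; rewrite /xsection/= inE.
pose a := rho ^+ d * b.
have a0 : 0 < a by rewrite mulr_gt0// exprn_gt0.
have := @markov_section _ _ _ _ _ P mu S D (expR (- (n%:R * c))) a mS mD.
move=> /(_ (fun w x => @proj1 _ _)) h.
have {}h : (a%:E * P [set w | a%:E <= mu (xsection S w)] <=
            (expR (- (n%:R * c)))%:E * mu D)%E.
  apply: h => // x Dx.
  rewrite (_ : ysection S x = [set w | V w x]); last first.
    by apply/seteqP; split => w; rewrite /ysection/= inE; [case|split].
  rewrite probability_in_voronoi lee_fin.
  rewrite (_ : - (n%:R * c) = - c * n%:R) ?expRM_natr; last by rewrite mulNr mulrC.
  have cap1 : cap_mass x <= 1.
    rewrite /cap_mass ler_pdivrMr ?vol_unit_ball_fine_gt0// mul1r fine_le//.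
    - exact: vol_cone_fin.
    - exact: vol_unit_ball_fin.
    - exact: vol_cone_le.
  have capx : c <= cap_mass x by apply: capc; case/andP: Dx.
  apply: lerXn2r; rewrite ?nnegrE ?expR_ge0//; first by lra.
  by apply: le_trans (expR_ge1Dx _); lra.
have mE : measurable [set w | (a%:E <= mu (xsection S w))%E].
  rewrite -[X in measurable X]setTI.
  by apply: emeasurable_fun_c_infty => //; exact: measurable_fun_xsection.
have mN : measurable [set w | exists i, enorm (X i w) != 1].
  rewrite (_ : mkset _ = \bigcup_(i in [set: 'I_n])
      ~` ((fun w => enorm (X i w)) @^-1` [set 1])).
    apply: fin_bigcup_measurable => // i _; apply: measurableC.
    by apply: measurable_preimage => //; exact: measurable_enorm.
  apply/seteqP; split => w /=; first by move=> [i /eqP hi]; exists i.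
  by move=> [i _ hi]; exists i; apply/eqP.
have PE : (P [set w | ((r2 ^+ d * b)%:E < mu (V w))%E] <=
    P [set w | (a%:E <= mu (xsection S w))%E])%E.
  (* Adding a null event on the right allows all vectors to be taken on the sphere. *)
  rewrite -[leRHS]adde0 -off_sphere_null.
  apply: le_trans (measureU2 _ mE mN); apply: le_measure; rewrite ?inE.
  - rewrite -[X in measurable X]setTI.
    by apply: emeasurable_fun_o_infty => //; exact: measurable_vol_voronoi.
  - exact: measurableU.
  move=> w /= Va.
  have [X1|/existsNP[i hi]] := pselect (forall i, enorm (X i w) = 1); last first.
    by right; exists i; apply/eqP.
  left; have [x Vx r2x] : exists2 x, V w x & r2 < enorm x.
    apply/not_exists2P => h'; move: Va; apply/negP; rewrite -leNgt.
    rewrite -vol_enorm_ball//; apply: le_measure; rewrite ?inE.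
    - exact: measurable_voronoi.
    - exact: measurable_enorm_ball.
    move=> x Vx /=; rewrite leNgt; apply/negP => ?.
    by case: (h' x).
  have sub := voronoi_contains_ball X1 Vx r1p r12 r2x rho1 rho2 rho0.
  rewrite SE /a EFinM fineK ?vol_unit_ball_fin//.
  rewrite -(vol_cball (tscale ((r1 + r2) / 2 / enorm x) x))//.
  apply: le_measure; rewrite ?inE//; first exact: measurable_cball.
  by apply: measurableI => //; exact: measurable_voronoi.
apply: (le_trans PE).
have {}h : (a%:E * P [set w | a%:E <= mu (xsection S w)] <=
            (expR (- (n%:R * c)) * (r2 ^+ d * b))%:E)%E.
  apply: (le_trans h); rewrite EFinM lee_pmul ?lee_fin ?expR_ge0//.
  rewrite -vol_enorm_ball//; apply: le_measure; rewrite ?inE//.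
    exact: measurable_enorm_ball.
  by move=> x /= /andP[].
rewrite -(fineK (fin_num_measure P _ mE)) -?EFinM !lee_fin in h *.
rewrite -(ler_pM2l a0) (le_trans h)// le_eqVlt; apply/orP; left; apply/eqP.
by rewrite /a expr_div_n; field; rewrite expf_neq0// gt_eqF.
Qed.

End random_voronoi.

(** * Growth rates, diagonal choice of the error, and choice of parameters *)

Section asymptotics.
Context {R : realType}.

Lemma bernoulli_expr_ge (phi : R) d : 1 < phi -> d%:R * (phi - 1) <= phi ^+ d.
Proof.
move=> phi1; elim: d => [|d IH]; first by rewrite mul0r expr0.
have : 1 <= phi ^+ d by rewrite exprn_ege1// ltW.
by rewrite exprS -natr1; nra.
Qed.

Lemma near_expr_ge (phi K : R) : 1 < phi -> \forall d \near \oo, K <= phi ^+ d.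
Proof.
move=> phi1.
have p0 : 0 < phi - 1 by lra.
near=> d; apply: (le_trans _ (bernoulli_expr_ge d phi1)); rewrite -ler_pdivrMr//.
near: d; exact: nbhs_infty_ger.
Unshelve. all: end_near. Qed.

(** Write [theta ^+ d] as the square of [phi ^+ d]: one factor outgrows any constant, the other is
    at least [d * (phi - 1)]. *)
Lemma near_expr_ge_linear (theta K : R) : 1 < theta ->
  \forall d \near \oo, K * d%:R <= theta ^+ d.
Proof.
move=> theta1; pose phi := Num.sqrt theta.
have phi1 : 1 < phi by rewrite -(@sqrtr1 R) ltr_sqrt//; lra.
have phiE : theta = phi ^+ 2 by rewrite sqr_sqrtr//; lra.
have p0 : 0 < phi - 1 by lra.
near=> d; rewrite phiE -exprM mulnC exprM.
have Kd : K / (phi - 1) <= phi ^+ d by near: d; exact: near_expr_ge.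
have : K <= phi ^+ d * (phi - 1) by rewrite -ler_pdivrMr.
have d0 : 0 <= d%:R :> R by [].
move=> /(ler_wpM2r d0) /le_trans; apply.
rewrite expr2 -mulrA ler_wpM2l ?exprn_ge0//; first by lra.
by rewrite mulrC bernoulli_expr_ge.
Unshelve. all: end_near. Qed.

Lemma cvg_expr0 (q : R) : 0 <= q < 1 -> q ^+ d @[d --> \oo] --> 0.
Proof. by move=> /andP[q0 q1]; apply: cvg_expr; rewrite ger0_norm. Qed.

(** Eventually [kappa * theta ^+ d >= (M + 1) * d]; with [M <= expR M] the product is at most
    [expR (-1) ^+ d]. *)
Lemma cvg_expR_expr0 (kappa theta M : R) : 0 < kappa -> 1 < theta -> 0 <= M ->
  expR (- (kappa * theta ^+ d)) * M ^+ d @[d --> \oo] --> 0.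
Proof.
move=> k0 t1 M0.
apply: (@squeeze_cvgr _ _ _ _ (cst 0) (fun d => expR (-1) ^+ d)).
- near=> d; rewrite mulr_ge0 ?expR_ge0 ?exprn_ge0//=.
  have h : (M + 1) / kappa * d%:R <= theta ^+ d.
    by near: d; exact: near_expr_ge_linear.
  have h' : (M + 1) * d%:R <= kappa * theta ^+ d.
    by move: h; rewrite mulrAC ler_pdivrMr// mulrC [leRHS]mulrC [leLHS]mulrC.
  apply: (@le_trans _ _ (expR (- ((M + 1) * d%:R)) * expR M ^+ d)).
    rewrite ler_pM ?expR_ge0 ?exprn_ge0//; first by rewrite ler_expR lerN2.
    rewrite lerXn2r ?nnegrE ?expR_ge0//.
    by apply: le_trans (expR_ge1Dx _); lra.
  rewrite -!expRM_natr -expRD ler_expR le_eqVlt; apply/orP; left; apply/eqP; ring.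
- exact: cvg_cst.
- by apply: cvg_expr0; rewrite expR_ge0/= -[ltRHS]expR0 ltr_expR; lra.
Unshelve. all: end_near. Qed.

(** Turns convergence for every fixed error into convergence along one vanishing error, by taking
    for each [d] almost the least [x] with [1 - x <= F d x]. *)
Lemma diagonal_rate (F : nat -> R -> R) :
  (forall d x y, x <= y -> F d x <= F d y) ->
  (forall d x, 0 <= F d x <= 1) ->
  (forall e, 0 < e -> F d e @[d --> \oo] --> (1 : R)) ->
  exists2 e : nat -> R, e @ \oo --> (0 : R) & F d (e d) @[d --> \oo] --> (1 : R).
Proof.
move=> Fnd F01 F1.
pose A d := [set x : R | 0 < x /\ 1 - x <= F d x].
have A1 d : A d 1 by split => //; rewrite subrr; case/andP: (F01 d 1).
have lbA d : lbound (A d) 0 by move=> x [/ltW].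
have infA d : has_inf (A d) by split; [exists 1|exists 0].
(* The infimum may not be attained; the vanishing extra term leaves an element of [A d] below
   [e d]. *)
pose e d := inf (A d) + d.+1%:R^-1.
have e0 d : 0 <= e d by rewrite addr_ge0// lb_le_inf//; exists 1.
have Fe d : 1 - e d <= F d (e d).
  have [|x [x0 xF] xe] := @inf_adherent _ (A d) d.+1%:R^-1 _ (infA d).
    by rewrite invr_gt0.
  by rewrite (@le_trans _ _ (1 - x))// ?lerD2l ?lerN2 ?(ltW xe)// (le_trans xF)// Fnd// ltW.
have ecvg : e @ \oo --> (0 : R).
  apply/cvgrPdist_le => /= eps eps0.
  have eps2 : 0 < eps / 2 by lra.
  have /cvgrPdist_le /(_ _ eps2) := F1 _ eps2.
  have /cvgrPdist_le /(_ _ eps2) := @cvg_harmonic R.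
  apply: filterS2 => d; rewrite sub0r normrN ger0_norm ?invr_ge0// => hd.
  rewrite /= ler_norml => /andP[_ hF].
  rewrite sub0r normrN ger0_norm//.
  have : inf (A d) <= eps / 2.
    apply: ge_inf; [by exists 0|split => //].
    by move: hF; rewrite !lerBlDr addrC.
  by move=> h; rewrite /e (splitr eps) lerD.
exists e => //.
apply: (@squeeze_cvgr _ _ _ _ (fun d => 1 - e d) (cst 1)).
- by near=> d; rewrite Fe/=; case/andP: (F01 d (e d)).
- by rewrite -[X in _ --> X]subr0; apply: cvgB => //; exact: cvg_cst.
- exact: cvg_cst.
Unshelve. all: end_near. Qed.

(** The witness is the logarithm of [x / (q * v)], and the two bounds exclude infinite [x]. In
    interval form the volume event is visibly measurable. *)
Lemma exists_expR_interval (q v G : R) (x : \bar R) : 0 < q -> 0 < v ->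
  (exists2 e, `|e| <= G & x = ((q * expR e)%:E * v%:E)%E) <->
  ((q * expR (- G) * v)%:E <= x /\ x <= (q * expR G * v)%:E)%E.
Proof.
move=> q0 v0; split.
  move=> [e]; rewrite ler_norml => /andP[e1 e2] ->.
  by rewrite -EFinM !lee_fin !ler_pM2r// !ler_pM2l// !ler_expR.
case: x => [x| |] [] //; rewrite ?lee_fin// => x1 x2.
have x0 : 0 < x by rewrite (lt_le_trans _ x1)// !mulr_gt0// expR_gt0.
have y0 : 0 < x / (q * v) by rewrite divr_gt0// mulr_gt0.
exists (ln (x / (q * v))); last first.
  rewrite lnK ?posrE// -EFinM; congr EFin.
  by field; rewrite !gt_eqF.
rewrite ler_norml -[X in X <= _ <= _]expRK -[X in _ <= _ <= X]expRK.
rewrite !ler_ln ?posrE ?expR_gt0//.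
rewrite ler_pdivlMr ?ler_pdivrMr ?mulr_gt0//.
by rewrite mulrCA mulrA x1/= mulrCA mulrA.
Qed.

(** With [A = alpha^2] and [T = (4 r^2)^-1], the bound on [r] says that the gap [D = 1/A - (1 - T)]
    is positive. Taking [q^2] in the middle of the gap and [e = D / 2] works since
    [e^2 <= D / 2]. *)
Lemma inner_parameters (alpha r : R) : 1 < alpha -> 1 / 2 <= r ->
  r ^+ 2 < alpha ^+ 2 / (4 * alpha ^+ 2 - 4) ->
  exists e q, [/\ 0 < e < 1, 0 < q, 1 - (4 * r ^+ 2)^-1 + e ^+ 2 <= q ^+ 2 &
    alpha * q < 1].
Proof.
move=> a1 r2 rb.
set A := alpha ^+ 2; set T := (4 * r ^+ 2)^-1.
have A1 : 1 < A by rewrite /A exprn_egt1.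
have T0 : 0 < T by rewrite invr_gt0 mulr_gt0// exprn_gt0//; lra.
have T1 : T <= 1 by rewrite invf_le1 ?mulr_gt0 ?exprn_gt0//; nra.
have TA : 1 - A^-1 < T.
  rewrite -[ltLHS]invrK ltf_pV2 ?posrE; last 2 first.
  - by rewrite invr_gt0 subr_gt0 invf_lt1//; lra.
  - by rewrite mulr_gt0// exprn_gt0//; lra.
  have -> : (1 - A^-1)^-1 = 4 * (A / (4 * A - 4)).
    by field; rewrite !gt_eqF//=; lra.
  by rewrite ltr_pM2l.
pose D := A^-1 - 1 + T.
have D0 : 0 < D by rewrite /D; lra.
have Ai : 0 < A^-1 < 1 by rewrite invr_gt0 invf_lt1; lra.
case/andP: Ai => Ai0 Ai1.
have D1 : D < 1 by rewrite /D; lra.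
have Q0 : 0 < A^-1 - D / 2 by rewrite /D; lra.
exists (D / 2), (Num.sqrt (A^-1 - D / 2)); split.
- by apply/andP; split; lra.
- by rewrite sqrtr_gt0.
- by rewrite sqr_sqrtr ?(ltW Q0)//; rewrite /D in D0 D1 *; nra.
- rewrite -(@ltr_pXn2r _ 2%N) ?nnegrE ?mulr_ge0 ?sqrtr_ge0//; last by lra.
  rewrite expr1n exprMn sqr_sqrtr ?(ltW Q0)// -/A mulrBr mulfV ?gt_eqF//; last by lra.
  by nra.
Qed.

(** With [T = 1 / (2 r)], the bound on [r] says that [G = 1 - 1/A - T^2] is positive. Half of [G]
    goes to [rho^2 = 1/A + G/2]. For [t = T + 2 h] the rest must cover [6 T h + 8 h^2 <= 14 h],
    whence [h = G / 28]. *)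
Lemma outer_parameters (alpha r : R) : 1 < alpha -> 0 < r ->
  alpha ^+ 2 / (4 * alpha ^+ 2 - 4) < r ^+ 2 ->
  exists t h rho (N : nat), [/\ 0 < rho, 0 < h, 0 <= t,
    t ^+ 2 + 2 * t * h + rho ^+ 2 <= 1 & 1 / 2 < r * (t - h)] /\
    rho < N%:R * h /\ 1 < alpha * rho.
Proof.
move=> a1 r0 br.
set A := alpha ^+ 2; pose T := (2 * r)^-1.
have A1 : 1 < A by rewrite /A exprn_egt1.
have T0 : 0 < T by rewrite invr_gt0 mulr_gt0.
have TA : T ^+ 2 < 1 - A^-1.
  rewrite -[ltRHS]invrK /T exprVn ltf_pV2 ?posrE; last 2 first.
  - by rewrite exprn_gt0// mulr_gt0.
  - by rewrite invr_gt0 subr_gt0 invf_lt1//; lra.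
  have -> : (1 - A^-1)^-1 = 4 * (A / (4 * A - 4)).
    by field; rewrite !gt_eqF//=; lra.
  by rewrite exprMn -natrX ltr_pM2l.
have Ai : 0 < A^-1 < 1 by rewrite invr_gt0 invf_lt1; lra.
case/andP: Ai => Ai0 Ai1.
pose G := 1 - A^-1 - T ^+ 2; have G0 : 0 < G by rewrite /G; lra.
have TT : 0 < T ^+ 2 by rewrite exprn_gt0.
have G1 : G < 1 by rewrite /G; lra.
have T1 : T < 1 by nra.
pose h := G / 28; have h0 : 0 < h by rewrite /h; lra.
have Q0 : 0 < A^-1 + G / 2 by lra.
pose rho := Num.sqrt (A^-1 + G / 2).
exists (T + 2 * h), h, rho, (Num.truncn (rho / h)).+1; split; [split|split] => //.
- by rewrite sqrtr_gt0.
- by lra.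
- rewrite sqr_sqrtr ?(ltW Q0)//.
  have hG : 28 * h = G by rewrite /h; field.
  have h1 : h < 1 by lra.
  have : h * (T + h) <= h * 2 by rewrite ler_pM2l//; lra.
  by move: hG; rewrite /G; nra.
- rewrite (_ : r * _ = 1 / 2 + r * h); last by rewrite /T; field; rewrite gt_eqF.
  by rewrite ltrDl mulr_gt0.
- by rewrite -ltr_pdivrMr// truncnS_gt.
- rewrite -(@ltr_pXn2r _ 2%N) ?nnegrE ?mulr_ge0 ?sqrtr_ge0//; last by lra.
  rewrite expr1n exprMn sqr_sqrtr ?(ltW Q0)// -/A mulrDr mulfV ?gt_eqF//; last by lra.
  by rewrite ltrDl mulr_gt0//; lra.
Qed.

End asymptotics.

(** * Concentration of the volume for each fixed error rate *)

Section voronoi_concentration.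
Context {R : realType} {alpha : R}.
Hypothesis alpha_gt1 : 1 < alpha.
Context {n : nat -> nat}.
Hypothesis nE : forall d, `|(n d)%:R - alpha ^+ d| < 1.
Context {disp : nat -> measure_display} {T : forall d, measurableType (disp d)}
  {P : forall d, probability (T d) R}
  {X : forall d, 'I_(n d) -> {RV (P d) >-> (d.-tuple R)%type}}.
Hypothesis X_indep : forall d, independent_RVs (@X d).
Hypothesis X_unif : forall d (i : 'I_(n d)) (A : set (d.-tuple R)), (0 < d)%N ->
  measurable A -> distribution (P d) (@X d i) A = sphere_uniform A.

Local Notation b := (alpha ^+ 2 / (4 * alpha ^+ 2 - 4)).
Local Notation V d w := (voronoi (range (fun i : 'I_(n d) => @X d i w))).
Local Notation ball_vol d := (fine (@vol_measure R d (unit_ball d))).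

(** The error is a factor [expR e] and not a power of [b], because for [alpha^2 = 4/3] the base [b]
    is 1 and its powers express no error. *)
Definition volume_event d (eps : R) : set (T d) :=
  [set w | exists2 e : R, `|e| <= eps * d%:R &
     vol (V d w) = ((b `^ (d%:R / 2) * expR e)%:E * vol (unit_ball d))%E].

Arguments volume_event d eps : clear implicits.

Lemma base_gt : 4^-1 < b.
Proof.
have a2 : 1 < alpha ^+ 2 by rewrite exprn_egt1.
by rewrite ltr_pdivlMr; lra.
Qed.

Lemma sqrt_base_gt : 1 / 2 < Num.sqrt b.
Proof.
have b4 := base_gt; have s0 := sqrtr_ge0 b.
have sb : Num.sqrt b ^+ 2 = b by rewrite sqr_sqrtr//; lra.
by rewrite -(@ltr_pXn2r _ 2%N) ?nnegrE// sb expr_div_n expr1n; lra.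
Qed.

Lemma powR_half_sqrt d : b `^ (d%:R / 2) = Num.sqrt b ^+ d.
Proof.
have b4 := base_gt.
by rewrite [d%:R / 2]mulrC powRrM powR12_sqrt ?powR_mulrn ?sqrtr_ge0//; lra.
Qed.

Lemma volume_eventE d eps : volume_event d eps =
  [set w | ((Num.sqrt b ^+ d * expR (- (eps * d%:R)) * ball_vol d)%:E <=
              vol_measure d (V d w))%E] `&`
  [set w | (vol_measure d (V d w) <=
             (Num.sqrt b ^+ d * expR (eps * d%:R) * ball_vol d)%:E)%E].
Proof.
have s0 : 0 < Num.sqrt b by have := sqrt_base_gt; lra.
have h w := exists_expR_interval (eps * d%:R) (vol_measure d (V d w))
  (exprn_gt0 d s0) (@vol_unit_ball_fine_gt0 R d).
rewrite /volume_event powR_half_sqrt -!vol_measureE.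
apply/seteqP; split => w /=.
  by rewrite -{1}(fineK (@vol_unit_ball_fin R d)) => /h.
by move=> /h; rewrite (fineK (@vol_unit_ball_fin R d)).
Qed.

Lemma measurable_volume_event d eps : measurable (volume_event d eps).
Proof.
rewrite volume_eventE; apply: measurableI; rewrite -[X in measurable X]setTI.
  by apply: emeasurable_fun_c_infty => //; exact: measurable_vol_voronoi.
by apply: emeasurable_fun_infty_c => //; exact: measurable_vol_voronoi.
Qed.

(** Off the event the volume is too small or too large; the lower tail just inside radius [s] and
    the upper tail just outside bound these cases by [p1 d] and [p2 d], which both vanish. *)
Lemma volume_event_cvg eps : 0 < eps ->
  fine (P d (volume_event d eps)) @[d --> \oo] --> (1 : R).
Proof.
move=> eps0.
have s2 := sqrt_base_gt; set s := Num.sqrt b in s2.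
have s0 : 0 < s by lra.
have sb : s ^+ 2 = b by rewrite sqr_sqrtr//; have := base_gt; lra.
(* Half of [eps] moves the radius away from [s]. The other half absorbs the factor 2 of the lower
   tail, as [2 <= E2 ^+ d] eventually, and gives the shell its width. *)
pose E2 := expR (eps / 2).
have E21 : 1 < E2 by rewrite -expR0 ltr_expR; lra.
have E20 : 0 < E2 by lra.
have EE : expR eps = E2 ^+ 2 by rewrite -expRM_natr; congr expR; lra.
(* The maximum secures [1 / 2 <= r], which the cone bound requires. *)
pose r := Num.max (1 / 2) (s / E2).
have rs : r < s by rewrite gt_max s2/= ltr_pdivrMr// ltr_pMr.
have r2 : 1 / 2 <= r by rewrite le_max lexx.
have r0 : 0 < r by lra.
have rE : s / E2 <= r by rewrite le_max lexx orbT.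
have [|e [q [e01 q0 hq aq1]]] := @inner_parameters R alpha r alpha_gt1 r2.
  by rewrite -sb; nra.
have sE : s < s * E2 by rewrite ltr_pMr.
have [||t [h [rho [N [[rho0 h0 t0 sq rth] [rhoN arho]]]]]] :=
  @outer_parameters R alpha (s * E2) alpha_gt1.
- by rewrite mulr_gt0.
- by rewrite -sb; nra.
(* The outer radius satisfies [r3 ^+ d = s ^+ d * expR (eps * d)], the upper limit in the event. *)
pose r1 := s * E2; pose r3 := s * E2 ^+ 2.
have r1p : 0 < r1 by rewrite mulr_gt0.
have r13 : r1 < r3 by rewrite /r1 /r3 ltr_pM2l// expr2 ltr_pMr.
have r3p : 0 < r3 by lra.
pose sg := Num.min ((r3 - r1) / 2) ((r3 - r1) / (4 * r3)).
have sg0 : 0 < sg by rewrite lt_min !divr_gt0 ?mulr_gt0// subr_gt0.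
have sg1 : sg <= (r3 - r1) / 2 by rewrite ge_min lexx.
have sg2 : sg <= (r3 - r1) / (4 * r3) by rewrite ge_min lexx orbT.
have N0 : 0 < (2 * N)%:R :> R.
  rewrite ltr0n muln_gt0/=; case: N rhoN => // /(lt_trans rho0).
  by rewrite mul0r ltxx.
case/andP: (e01) => e0 e1.
(* Absorbs the rounding: for [d > 0], [n d >= alpha ^+ d - 1 >= (1 - alpha^-1) * alpha ^+ d]. *)
pose kappa := (1 - alpha^-1) / (2 * N)%:R.
have a0 : 0 < alpha by exact: lt_trans alpha_gt1.
have kappa0 : 0 < kappa by rewrite divr_gt0// subr_gt0 invf_lt1.
(* The summand [q ^+ d] comes from rounding, as [n d <= alpha ^+ d + 1]. *)
pose p1 d := 2 / e * ((alpha * q) ^+ d + q ^+ d).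
pose p2 d := expR (- (kappa * (alpha * rho) ^+ d)) * (r3 / sg) ^+ d.
have p12 : 1 - (p1 d + p2 d) @[d --> \oo] --> (1 : R).
  rewrite -[X in _ --> X]subr0 -[X in _ --> _ - X]addr0.
  apply: cvgB; first exact: cvg_cst.
  apply: cvgD; last by apply: cvg_expR_expr0 => //; rewrite divr_ge0// ltW.
  rewrite -(mulr0 (2 / e)) -[X in _ * X]addr0; apply: cvgMr; apply: cvgD.
    by apply: cvg_expr0; rewrite aq1 mulr_ge0//; lra.
  by apply: cvg_expr0; rewrite (ltW q0)/= (lt_trans _ aq1)// ltr_pMl.
apply: (@squeeze_cvgr _ _ _ _ (fun d => 1 - (p1 d + p2 d)) (cst 1)) => //; last exact: cvg_cst.
near=> d.
have d0 : (0 < d)%N by near: d; exact: nbhs_infty_gt.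
have E2d : 2 <= E2 ^+ d by near: d; exact: near_expr_ge.
have mVE := measurable_volume_event d eps.
have finE := fin_num_measure (P d) _ mVE.
rewrite -!lee_fin fineK//= probability_le1// andbT.
have nd := nE d; rewrite ltr_norml in nd; case/andP: nd => nd1 nd2.
have ad0 : 0 < alpha ^+ d by rewrite exprn_gt0//; lra.
have qd0 : 0 < q ^+ d by rewrite exprn_gt0.
have lower := @vol_voronoi_lower_tail R _ (T d) (P d) d (n d) (@X d)
  (fun i A mA => X_unif i d0 mA) r (q ^+ d / e) r0
  (fun x => cap_mass_upper d0 r2 e01 q0 hq).
have upper := @vol_voronoi_upper_tail R _ (T d) (P d) d (n d) (@X d)
  (@X_indep d) (fun i A mA => X_unif i d0 mA) r1 r3 (rho ^+ d / (2 * N)%:R) sg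
  r1p r13 sg1 sg2 sg0
  (fun x h1 => cap_mass_lower r1p h1 rho0 h0 t0 sq rth rhoN).
set lowE := [set w | _] in lower; set upE := [set w | _] in upper.
have mlow : measurable lowE.
  rewrite -[X in measurable X]setTI.
  by apply: emeasurable_fun_infty_o => //; exact: measurable_vol_voronoi.
have mup : measurable upE.
  rewrite -[X in measurable X]setTI.
  by apply: emeasurable_fun_o_infty => //; exact: measurable_vol_voronoi.
have bv0 := @vol_unit_ball_fine_gt0 R d.
have sub : ~` volume_event d eps `<=` lowE `|` upE.
  move=> w; rewrite volume_eventE -/s setCI => -[|] /= /negP; rewrite -ltNge => hw; [left|right].
    rewrite /lowE/= (lt_le_trans hw)// lee_fin ler_pM2r//.
    apply: (@le_trans _ _ ((s / E2) ^+ d / 2)); last first.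
      by rewrite ler_pM2r// lerXn2r// nnegrE ?divr_ge0// ltW.
    rewrite expr_div_n -mulrA ler_pM2l ?exprn_gt0//.
    rewrite expRN expRM_natr EE -exprM mulnC exprM expr2.
    by rewrite -invfM lef_pV2 ?posrE ?mulr_gt0 ?exprn_gt0// ler_pM2l// exprn_gt0.
  rewrite /upE/= (le_lt_trans _ hw)// lee_fin ler_pM2r// /r3 exprMn.
  by rewrite expRM_natr EE.
have PC : (P d (~` volume_event d eps) <= (p1 d + p2 d)%:E)%E.
  apply: (@le_trans _ _ (P d (lowE `|` upE))).
    by apply: le_measure; rewrite ?inE//; [exact: measurableC|exact: measurableU].
  apply: (le_trans (measureU2 _ mlow mup)); rewrite EFinD.
  apply: leeD; [apply: (le_trans lower)|apply: (le_trans upper)]; rewrite lee_fin.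
    have -> : p1 d = 2 * ((alpha ^+ d + 1) * (q ^+ d / e)).
      by rewrite /p1 exprMn; field; rewrite gt_eqF.
    by rewrite -mulrA ler_pM2l// ler_pM2r ?divr_gt0//; lra.
  rewrite /p2 ler_pM2r ?exprn_gt0 ?divr_gt0// ler_expR lerN2.
  rewrite /kappa exprMn mulrAC !mulrA ler_pM2r ?invr_gt0//.
  rewrite ler_pM2r ?exprn_gt0//.
  have : 1 <= alpha^-1 * alpha ^+ d.
    by case: (d) d0 => // k _; rewrite exprS mulKf ?gt_eqF ?exprn_ege1// ltW.
  by rewrite mulrBl mul1r; lra.
have := PC; rewrite probability_setC// -(fineK finE) -EFinB !lee_fin.
by lra.
Unshelve. all: end_near. Qed.

End voronoi_concentration.

(** * From fixed error rates to an error of order [o(d)] *)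

Lemma littleo_mul_cvg0 (R : realType) (e : nat -> R) (c : R) :
  e @ \oo --> (0 : R) ->
  (fun d => e d * d%:R / c) =o_\oo (fun d : nat => d%:R : R).
Proof.
move=> e0; apply/eqoP => eps eps0.
have ec : e d / c @[d --> \oo] --> (0 : R).
  by rewrite -(mul0r c^-1); exact: cvgMl.
move/cvgrPdist_le : ec => /(_ _ eps0); apply: filterS => d /=.
rewrite sub0r normrN => h.
by rewrite mulrAC normrM ler_wpM2r.
Qed.

Theorem theorem3 (R : realType) (alpha : R) (alpha_gt1 : 1 < alpha)
    (n : nat -> nat) (nE : forall d, `|(n d)%:R - alpha ^+ d| < 1)
    (disp : nat -> measure_display) (T : forall d, measurableType (disp d))
    (P : forall d, probability (T d) R)
    (X : forall d, 'I_(n d) -> {RV (P d) >-> (d.-tuple R)%type})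
    (X_indep : forall d, independent_RVs (@X d))
    (X_unif : forall d (i : 'I_(n d)) (A : set (d.-tuple R)), (0 < d)%N ->
       measurable A -> distribution (P d) (@X d i) A = sphere_uniform A) :
  let b := alpha ^+ 2 / (4 * alpha ^+ 2 - 4) in
  let L d (w : T d) := range (fun i : 'I_(n d) => @X d i w) in
  (b != 1 ->
   exists2 g : nat -> R, g =o_\oo (fun d : nat => d%:R : R) &
     P d [set w | exists2 e : R, `|e| <= g d &
            vol (voronoi (L d w))
            = ((b `^ (d%:R / 2 + e))%:E * vol (unit_ball d))%E]
       @[d --> \oo] --> 1%E) /\
  (exists2 g : nat -> R, g =o_\oo (fun d : nat => d%:R : R) &
     P d [set w | exists2 e : R, `|e| <= g d &
            vol (voronoi (L d w))
            = ((b `^ (d%:R / 2) * expR e)%:E * vol (unit_ball d))%E]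
       @[d --> \oo] --> 1%E).
Proof.
set b := _ / _ => L.
pose E d := @volume_event R alpha n disp T P X d.
have mE d eps : measurable (E d eps) by exact: measurable_volume_event.
have finE d eps := fin_num_measure (P d) _ (mE d eps).
(* One sequence [e d] tending to 0 replaces all fixed rates, so the error [e d * d] is [o(d)]. *)
have [|||e e0 Pe] := @diagonal_rate R (fun d eps => fine (P d (E d eps))).
- move=> d x y xy; apply: fine_le; [exact: finE|exact: finE|]; apply: le_measure; rewrite ?inE//.
  by move=> w [f fx Vf]; exists f => //; rewrite (le_trans fx)// ler_wpM2r.
- by move=> d x; rewrite fine_ge0//= -lee_fin fineK ?finE// probability_le1.
- by move=> eps eps0; exact: volume_event_cvg.
have {}Pe : P d (E d (e d)) @[d --> \oo] --> 1%E.
  by apply: cvg_EFin; [apply: nearW => d; exact: finE|exact: Pe].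
have b0 : 0 < b by have := base_gt alpha_gt1; rewrite -/b; lra.
split; last first.
  exists (fun d => e d * d%:R / 1); first exact: littleo_mul_cvg0.
  rewrite (_ : (fun d => _) = fun d => P d (E d (e d)))//.
  by apply/funext => d; congr (P d _); apply/funext => w; rewrite divr1.
(* For [b] other than 1, [expR f] is the power of [b] with exponent [f / ln b], so the bound on the
   error is divided by [|ln b|]. *)
move=> b1; have lnb : ln b != 0 by rewrite ln_eq0.
have lnb0 : 0 < `|ln b| by rewrite normr_gt0.
exists (fun d => e d * d%:R / `|ln b|); first exact: littleo_mul_cvg0.
rewrite (_ : (fun d => _) = fun d => P d (E d (e d)))//.
apply/funext => d; congr (P d _); apply/seteqP; split => w [f fe Vf].
  exists (f * ln b); first by rewrite normrM -ler_pdivlMr.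
  rewrite Vf; congr (_%:E * _)%E.
  rewrite powRD; last by rewrite (gt_eqF b0) implybT.
  by rewrite /powR (gt_eqF b0).
exists (f / ln b); first by rewrite normrM normfV ler_pM2r// invr_gt0.
rewrite Vf; congr (_%:E * _)%E.
rewrite powRD; last by rewrite (gt_eqF b0) implybT.
by rewrite [in RHS]/powR (gt_eqF b0) divfK// /powR (gt_eqF b0).
Qed.
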